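(* Let $\mathbb{F}$ be a field of characteristic $0$ and $A=(a_{ij})$ a simply laced generalized Cartan matrix, indexed by a set $\mathcal{V}$, with associated labeled graph $\Gamma=(\mathcal{V},\mathcal{E},\lambda)$, all of whose labels are $-1$. Let $\mathfrak{KM}(A)$ be the Kac-Moody Lie algebra over $\mathbb{F}$. Then the compact Lie subalgebra $\mathfrak{K}(A)$ of $\mathfrak{KM}(A)$ admits a quotient isomorphic to $\mathfrak{K}(\Gamma)$ and, in particular, admits a generalized spin representation.
   Context: A simply laced generalized Cartan matrix indexed by $\mathcal{V}$ has $a_{ii}=2$ and $a_{ij}=a_{ji}\in\{0,-1\}$ for $i\neq j$. Its associated labeled graph $\Gamma$ has vertex set $\mathcal{V}$, distinct $x,y$ adjacent iff $a_{xy}\neq0$, and $\lambda(x)=-1$ for all $x\in\mathcal{V}$; $x\sim y$ denotes adjacency. $\mathfrak{KM}(A)$ is the Lie algebra over $\mathbb{F}$ generated by $e_i,f_i,h_i$ ($i\in\mathcal{V}$) subject to $[h_i,h_j]=0$, $[h_i,e_j]=a_{ij}e_j$, $[h_i,f_j]=-a_{ij}f_j$, $[e_i,f_i]=h_i$ for all $i,j$, and for $i\neq j$: $[e_i,f_j]=0$; $[e_i,e_j]=[f_i,f_j]=0$ if $a_{ij}=0$; $[e_i,[e_i,e_j]]=[f_i,[f_i,f_j]]=0$. The compact subalgebra $\mathfrak{K}(A)$ is the Lie subalgebra generated by the elements $e_i-f_i$, $i\in\mathcal{V}$. $\mathfrak{C}(\Gamma)$ is the associative $\mathbb{F}$-algebra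 with identity $\mathbf{1}$ generated by $\mathcal{V}$ subject to $v^2=\lambda(v)\mathbf{1}=-\mathbf{1}$; $vw+wv=0$ if $v\sim w$; $vw-wv=0$ if $v\not\sim w$. $\mathfrak{C}(\Gamma)^-$ is the Lie algebra on $\mathfrak{C}(\Gamma)$ with $[x,y]=\frac12(xy-yx)$, and $\mathfrak{K}(\Gamma)$ is its Lie subalgebra generated by $\mathcal{V}$. For a vector space $W$ over $\mathbb{F}$, $\mathfrak{gl}(W)$ is the space of linear maps of $W$ with the Lie product $[x,y]=\frac12(xy-yx)$. A generalized spin representation of $\mathfrak{K}(A)$ is a Lie algebra homomorphism $\phi:\mathfrak{K}(A)\to\mathfrak{gl}(W)$, for some $\mathbb{F}$-vector space $W$, with $\phi(e_i-f_i)^2=-\mathbf{1}_W$ for all $i\in\mathcal{V}$. *)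

(* Defs.v *)
From HB Require Import structures.
From mathcomp Require Import all_boot all_order all_algebra.
From mathcomp Require Import mathcomp_extra boolp classical_sets.

Set Implicit Arguments.
Unset Strict Implicit.
Unset Printing Implicit Defensive.

Import GRing.Theory.

Local Open Scope ring_scope.
Local Open Scope classical_set_scope.
Local Open Scope quotient_scope.

Reserved Notation "⁅ x , y ⁆" (at level 0, x at level 99, y at level 99,
  format "⁅ x ,  y ⁆").

HB.mixin Record Lmodule_isLieAlgebra (F : fieldType) L of GRing.Lmodule F L := {
  lbr : L -> L -> L;
  lbrPl : forall (a : F) x y z, lbr (a *: x + y) z = a *: lbr x z + lbr y z;
  lbrPr : forall (a : F) x y z, lbr x (a *: y + z) = a *: lbr x y + lbr x z;
  lbrxx : forall x, lbr x x = 0;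
  lbr_jacobi : forall x y z,
    lbr x (lbr y z) + lbr y (lbr z x) + lbr z (lbr x y) = 0
}.

#[short(type="lieAlgType")]
HB.structure Definition LieAlgebra (F : fieldType) :=
  {L of GRing.Lmodule F L & Lmodule_isLieAlgebra F L}.

Notation "⁅ x , y ⁆" := (lbr x y) : ring_scope.

(* The Lie algebra of an associative algebra, with bracket (xy - yx) / 2. This *)
(* takes a ring with compatible scaling instead of an [algType], which forces *)
(* 1 != 0: an endomorphism algebra or a presented algebra may be zero.        *)
HB.factory Record Assoc_isLieAlgebra (F : fieldType) B
    of GRing.PzRing B & GRing.Lmodule F B := {
  assoc_scalerAl : forall (a : F) (x y : B), a *: (x * y) = (a *: x) * y;
  assoc_scalerAr : forall (a : F) (x y : B), a *: (x * y) = x * (a *: y)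
}.

HB.builders Context F B of Assoc_isLieAlgebra F B.

Implicit Types x y z : B.

Definition half_comm x y : B := (2%:R : F)^-1 *: (x * y - y * x).

Fact half_commPl (a : F) x y z :
  half_comm (a *: x + y) z = a *: half_comm x z + half_comm y z.
Proof.
rewrite /half_comm mulrDl mulrDr opprD addrACA scalerDr -assoc_scalerAl.
by rewrite -assoc_scalerAr -scalerBr !scalerA mulrC.
Qed.

Fact half_commxx x : half_comm x x = 0.
Proof. by rewrite /half_comm subrr scaler0. Qed.

Fact half_commC x y : half_comm x y = - half_comm y x.
Proof. by rewrite /half_comm -scalerN opprB. Qed.

Fact half_commPr (a : F) x y z :
  half_comm x (a *: y + z) = a *: half_comm x y + half_comm x z.
Proof.
by rewrite half_commC half_commPl opprD -scalerN -!(half_commC x).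
Qed.

Fact half_comm_jacobi x y z :
  half_comm x (half_comm y z) + half_comm y (half_comm z x)
    + half_comm z (half_comm x y) = 0.
Proof.
have E u v w : half_comm u (half_comm v w) = (2%:R : F)^-1 *: ((2%:R : F)^-1 *:
    ((u * v * w + w * v * u) - (u * w * v + v * w * u))).
  rewrite /half_comm -assoc_scalerAl -assoc_scalerAr -scalerBr mulrBr mulrBl.
  by rewrite !mulrA opprB addrACA -opprD.
have T (p q r : B) : (p - q) + (q - r) + (r - p) = 0.
  by rewrite !addrA !subrK subrr.
rewrite !E -!scalerDr (addrC (y * z * x)) (addrC (z * x * y)).
by rewrite (addrC (z * y * x)) T !scaler0.
Qed.

HB.instance Definition _ := Lmodule_isLieAlgebra.Build F B
  half_commPl half_commPr half_commxx half_comm_jacobi.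

HB.end.

Section LieNotions.
Variable F : fieldType.
Implicit Types L M : lieAlgType F.

Definition lie_hom L M (f : L -> M) : Prop :=
  linear f /\ forall x y, f ⁅x, y⁆ = ⁅f x, f y⁆.

Definition lie_isomorphic L M : Prop :=
  exists f : L -> M, lie_hom f /\ bijective f.

Definition is_lie_subalgebra L (S : set L) : Prop :=
  [/\ S 0, forall (a : F) x y, S x -> S y -> S (a *: x + y)
    & forall x y, S x -> S y -> S ⁅x, y⁆].

Definition is_lie_ideal L (I : set L) : Prop :=
  [/\ I 0, forall (a : F) x y, I x -> I y -> I (a *: x + y)
    & forall x y, I y -> I ⁅x, y⁆].

Record lie_ideal L := LieIdeal {
  ideal_set :> L -> Prop;
  ideal_setP : is_lie_ideal ideal_set
}.

End LieNotions.

Section LieTheory.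
Variables (F : fieldType) (L : lieAlgType F).
Implicit Types (a : F) (x y z : L).

Lemma lbrDl x y z : ⁅x + y, z⁆ = ⁅x, z⁆ + ⁅y, z⁆.
Proof. by have := lbrPl 1 x y z; rewrite !scale1r. Qed.

Lemma lbrDr x y z : ⁅x, y + z⁆ = ⁅x, y⁆ + ⁅x, z⁆.
Proof. by have := lbrPr 1 x y z; rewrite !scale1r. Qed.

Lemma lbrBr x y z : ⁅x, y - z⁆ = ⁅x, y⁆ - ⁅x, z⁆.
Proof. by rewrite addrC -scaleN1r lbrPr scaleN1r addrC. Qed.

Lemma lbrC x y : ⁅x, y⁆ = - ⁅y, x⁆.
Proof.
apply/eqP; rewrite -subr_eq0 opprK; apply/eqP.
have := lbrxx (x + y).
by rewrite lbrDl !lbrDr !lbrxx add0r addr0.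
Qed.

End LieTheory.

Section GeneratedSubalgebra.
Variables (F : fieldType) (L : lieAlgType F) (S : set L).

Definition lie_span : set L := smallest (@is_lie_subalgebra F L) S.

Lemma lie_span_subalgebra : is_lie_subalgebra lie_span.
Proof.
split.
- by move=> T [[T0 _ _] _].
- move=> a x y Sx Sy T [TP ST]; case: (TP) => _ Tlin _.
  by apply: Tlin; [apply: Sx | apply: Sy].
- move=> x y Sx Sy T [TP ST]; case: (TP) => _ _ Tbr.
  by apply: Tbr; [apply: Sx | apply: Sy].
Qed.

Definition lie_span_pred : {pred L} := fun x => `[< lie_span x >].

Fact lie_span_submod_closed : GRing.subsemimod_closed lie_span_pred.
Proof.
have [S0 Slin _] := lie_span_subalgebra.
split; first split.
- exact/asboolP.
- move=> x y /asboolP Sx /asboolP Sy; apply/asboolP.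
  by rewrite -[x]scale1r; apply: Slin.
- move=> a x /asboolP Sx; apply/asboolP.
  by rewrite -[_ *: _]addr0; apply: Slin.
Qed.

Definition generated_subalgebra : Type := {x : L | x \in lie_span_pred}.

HB.instance Definition _ := SubChoice.on generated_subalgebra.
HB.instance Definition _ := GRing.SubChoice_isSubLmodule.Build F L
  lie_span_pred generated_subalgebra lie_span_submod_closed.

Implicit Types x y z : generated_subalgebra.

Fact lie_span_lbr x y : ⁅val x, val y⁆ \in lie_span_pred.
Proof.
have [_ _ Sbr] := lie_span_subalgebra.
by apply/asboolP; apply: Sbr; apply/asboolP; [exact: (valP x)|exact: (valP y)].
Qed.

Definition gs_lbr x y : generated_subalgebra :=
  exist _ ⁅val x, val y⁆ (lie_span_lbr x y).

Fact gs_lbrPl (a : F) x y z :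
  gs_lbr (a *: x + y) z = a *: gs_lbr x z + gs_lbr y z.
Proof. by apply: val_inj; rewrite /= lbrPl. Qed.

Fact gs_lbrPr (a : F) x y z :
  gs_lbr x (a *: y + z) = a *: gs_lbr x y + gs_lbr x z.
Proof. by apply: val_inj; rewrite /= lbrPr. Qed.

Fact gs_lbrxx x : gs_lbr x x = 0.
Proof. by apply: val_inj; rewrite /= lbrxx. Qed.

Fact gs_jacobi x y z :
  gs_lbr x (gs_lbr y z) + gs_lbr y (gs_lbr z x) + gs_lbr z (gs_lbr x y) = 0.
Proof. by apply: val_inj; rewrite /= lbr_jacobi. Qed.

HB.instance Definition _ := Lmodule_isLieAlgebra.Build F generated_subalgebra
  gs_lbrPl gs_lbrPr gs_lbrxx gs_jacobi.

Fact lie_span_gen (x : L) : S x -> x \in lie_span_pred.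
Proof. by move=> Sx; apply/asboolP; apply: sub_gen_smallest. Qed.

Definition span_gen (x : L) (Sx : S x) : generated_subalgebra :=
  exist _ x (lie_span_gen Sx).

End GeneratedSubalgebra.

Section LieQuotient.
Variables (F : fieldType) (L : lieAlgType F) (I : lie_ideal L).

Definition ideal_equiv : rel L := fun x y => `[< I (x - y) >].

Fact ideal_equiv_is_equiv : equiv_class_of ideal_equiv.
Proof.
have [I0 Ilin _] := ideal_setP I; split=> [x|x y|y x z].
- by apply/asboolP; rewrite subrr.
- by apply/asboolP/asboolP => Ixy; have := Ilin (-1) _ _ Ixy I0;
    rewrite scaleN1r opprB addr0.
- move=> /asboolP Ixy /asboolP Iyz; apply/asboolP.
  by have := Ilin 1 _ _ Ixy Iyz; rewrite scale1r addrA subrK.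
Qed.

Canonical ideal_equiv_equiv := EquivRelPack ideal_equiv_is_equiv.
Canonical ideal_equiv_encModRel := defaultEncModRel ideal_equiv.

Definition lie_quot : Type := {eq_quot ideal_equiv}.
HB.instance Definition _ := Choice.on lie_quot.
HB.instance Definition _ : EqQuotient L ideal_equiv lie_quot :=
  EqQuotient.on lie_quot.

Local Notation p := (\pi_lie_quot).

Lemma lie_quot_eqP (x y : L) : p x = p y <-> I (x - y).
Proof.
split=> [/eqmodP/asboolP //|Ixy]; exact/eqmodP/asboolP.
Qed.

Lemma lie_quot_reprP (x : L) : I (repr (p x) - x).
Proof. by apply/lie_quot_eqP; rewrite reprK. Qed.

Definition lq_zero : lie_quot := p 0.
Definition lq_opp :=
  locked (fun x : lie_quot => p (- repr x)).
Definition lq_add :=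
  locked (fun x y : lie_quot => p (repr x + repr y)).
Definition lq_scale :=
  locked (fun (a : F) (x : lie_quot) => p (a *: repr x)).
Definition lq_lbr :=
  locked (fun x y : lie_quot => p ⁅repr x, repr y⁆).

Lemma lq_addE x y : lq_add (p x) (p y) = p (x + y).
Proof.
rewrite /lq_add -lock; have [I0 Ilin _] := ideal_setP I; apply/lie_quot_eqP;
  rewrite opprD addrACA.
by rewrite -[X in X + _]scale1r; apply: Ilin; apply: lie_quot_reprP.
Qed.

Lemma lq_scaleE a x : lq_scale a (p x) = p (a *: x).
Proof.
rewrite /lq_scale -lock; have [I0 Ilin _] := ideal_setP I;
  apply/lie_quot_eqP; rewrite -scalerBr.
by rewrite -[X in I X]addr0; apply: Ilin => //; apply: lie_quot_reprP.
Qed.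

Lemma lq_oppE x : lq_opp (p x) = p (- x).
Proof. by rewrite -scaleN1r -lq_scaleE /lq_opp /lq_scale -!lock scaleN1r. Qed.

Lemma lq_lbrE x y : lq_lbr (p x) (p y) = p ⁅x, y⁆.
Proof.
rewrite /lq_lbr -lock; have [I0 Ilin Ibr] := ideal_setP I; apply/lie_quot_eqP.
have -> : ⁅repr (p x), repr (p y)⁆ - ⁅x, y⁆ =
    -1 *: ⁅repr (p y), repr (p x) - x⁆ + ⁅x, repr (p y) - y⁆.
  rewrite scaleN1r !lbrBr opprB (lbrC _ x) (lbrC _ (repr (p x))) opprK.
  by rewrite (addrC (- _)) addrA subrK.
by apply: Ilin; apply: Ibr; apply: lie_quot_reprP.
Qed.

Let pE := (lq_addE, lq_scaleE, lq_oppE, lq_lbrE).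

Fact lq_addA : associative lq_add.
Proof.
by move=> x y z; elim/quotW: x => x; elim/quotW: y => y; elim/quotW: z => z;
  rewrite !pE addrA.
Qed.
Fact lq_addC : commutative lq_add.
Proof.
by move=> x y; elim/quotW: x => x; elim/quotW: y => y; rewrite !pE addrC.
Qed.
Fact lq_add0 : left_id lq_zero lq_add.
Proof. by move=> x; elim/quotW: x => x; rewrite !pE add0r. Qed.
Fact lq_addN : left_inverse lq_zero lq_opp lq_add.
Proof. by move=> x; elim/quotW: x => x; rewrite !pE addNr. Qed.

HB.instance Definition _ :=
  GRing.isZmodule.Build lie_quot lq_addA lq_addC lq_add0 lq_addN.

Fact lq_scaleA a b x : lq_scale a (lq_scale b x) = lq_scale (a * b) x.
Proof. by elim/quotW: x => x; rewrite !pE scalerA. Qed.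
Fact lq_scale1 : left_id 1 lq_scale.
Proof. by move=> x; elim/quotW: x => x; rewrite !pE scale1r. Qed.
Fact lq_scaleDr : right_distributive lq_scale +%R.
Proof.
by move=> a x y; elim/quotW: x => x; elim/quotW: y => y;
  rewrite /GRing.add /= !pE scalerDr.
Qed.
Fact lq_scaleDl x : {morph lq_scale^~ x : a b / a + b}.
Proof. by elim/quotW: x => x a b; rewrite [RHS]/GRing.add /= !pE scalerDl. Qed.

HB.instance Definition _ := GRing.Zmodule_isLmodule.Build F lie_quot
  lq_scaleA lq_scale1 lq_scaleDr lq_scaleDl.

Fact pi_lq_lin (a : F) x y : p (a *: x + y) = a *: p x + p y.
Proof. by rewrite -lq_addE -lq_scaleE. Qed.

Fact lq_lbrPl (a : F) x y z :
  lq_lbr (a *: x + y) z = a *: lq_lbr x z + lq_lbr y z.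
Proof.
elim/quotW: x => x; elim/quotW: y => y; elim/quotW: z => z.
by rewrite -pi_lq_lin !pE lbrPl pi_lq_lin.
Qed.
Fact lq_lbrPr (a : F) x y z :
  lq_lbr x (a *: y + z) = a *: lq_lbr x y + lq_lbr x z.
Proof.
elim/quotW: x => x; elim/quotW: y => y; elim/quotW: z => z.
by rewrite -pi_lq_lin !pE lbrPr pi_lq_lin.
Qed.
Fact lq_lbrxx x : lq_lbr x x = 0.
Proof. by elim/quotW: x => x; rewrite pE lbrxx. Qed.
Fact lq_jacobi x y z :
  lq_lbr x (lq_lbr y z) + lq_lbr y (lq_lbr z x) + lq_lbr z (lq_lbr x y) = 0.
Proof.
elim/quotW: x => x; elim/quotW: y => y; elim/quotW: z => z.
by rewrite !pE /GRing.add /= !pE lbr_jacobi.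
Qed.

HB.instance Definition _ := Lmodule_isLieAlgebra.Build F lie_quot
  lq_lbrPl lq_lbrPr lq_lbrxx lq_jacobi.

End LieQuotient.

(* Lie algebras given by generators and relations: formal Lie expressions in  *)
(* the generators, modulo the least congruence containing the Lie algebra     *)
(* axioms and the relations.                                                  *)
Inductive lie_term (F G : Type) : Type :=
| LGen of G
| LZero
| LOpp of lie_term F G
| LAdd of lie_term F G & lie_term F G
| LScale of F & lie_term F G
| LBr of lie_term F G & lie_term F G.

Arguments LGen {F G}.
Arguments LZero {F G}.

HB.instance Definition _ F G := gen_eqMixin (lie_term F G).
HB.instance Definition _ F G := gen_choiceMixin (lie_term F G).

Inductive lie_cong (F : fieldType) (G : Type)
    (R : lie_term F G -> lie_term F G -> Prop) :
    lie_term F G -> lie_term F G -> Prop :=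
| lc_rel x y : R x y -> lie_cong R x y
| lc_refl x : lie_cong R x x
| lc_sym x y : lie_cong R x y -> lie_cong R y x
| lc_trans x y z : lie_cong R x y -> lie_cong R y z -> lie_cong R x z
| lc_opp x x' : lie_cong R x x' -> lie_cong R (LOpp x) (LOpp x')
| lc_add x x' y y' : lie_cong R x x' -> lie_cong R y y' ->
    lie_cong R (LAdd x y) (LAdd x' y')
| lc_scale a x x' : lie_cong R x x' -> lie_cong R (LScale a x) (LScale a x')
| lc_br x x' y y' : lie_cong R x x' -> lie_cong R y y' ->
    lie_cong R (LBr x y) (LBr x' y')
| lc_addA x y z : lie_cong R (LAdd x (LAdd y z)) (LAdd (LAdd x y) z)
| lc_addC x y : lie_cong R (LAdd x y) (LAdd y x)
| lc_add0 x : lie_cong R (LAdd LZero x) x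
| lc_addN x : lie_cong R (LAdd (LOpp x) x) LZero
| lc_scaleA a b x : lie_cong R (LScale a (LScale b x)) (LScale (a * b) x)
| lc_scale1 x : lie_cong R (LScale 1 x) x
| lc_scaleDr a x y :
    lie_cong R (LScale a (LAdd x y)) (LAdd (LScale a x) (LScale a y))
| lc_scaleDl a b x :
    lie_cong R (LScale (a + b) x) (LAdd (LScale a x) (LScale b x))
| lc_brPl a x y z : lie_cong R
    (LBr (LAdd (LScale a x) y) z) (LAdd (LScale a (LBr x z)) (LBr y z))
| lc_brPr a x y z : lie_cong R
    (LBr x (LAdd (LScale a y) z)) (LAdd (LScale a (LBr x y)) (LBr x z))
| lc_brxx x : lie_cong R (LBr x x) LZero
| lc_jacobi x y z : lie_cong R
    (LAdd (LAdd (LBr x (LBr y z)) (LBr y (LBr z x))) (LBr z (LBr x y))) LZero.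

Section PresentedLie.
Variables (F : fieldType) (G : Type) (R : lie_term F G -> lie_term F G -> Prop).

Definition lie_congb : rel (lie_term F G) := fun x y => `[< lie_cong R x y >].

Fact lie_congb_is_equiv : equiv_class_of lie_congb.
Proof.
split=> [x|x y|y x z].
- exact/asboolP/lc_refl.
- by apply/asboolP/asboolP; apply: lc_sym.
- by move=> /asboolP xy /asboolP yz; apply/asboolP; apply: lc_trans yz.
Qed.

Canonical lie_congb_equiv := EquivRelPack lie_congb_is_equiv.
Canonical lie_congb_encModRel := defaultEncModRel lie_congb.

Definition presented_lie : Type := {eq_quot lie_congb}.
HB.instance Definition _ := Choice.on presented_lie.
HB.instance Definition _ : EqQuotient (lie_term F G) lie_congb presented_lie :=
  EqQuotient.on presented_lie.

Local Notation p := (\pi_presented_lie).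

Lemma presented_lie_eqP x y : p x = p y <-> lie_cong R x y.
Proof. by split=> [/eqmodP/asboolP //|xy]; apply/eqmodP/asboolP. Qed.

Lemma presented_lie_reprP x : lie_cong R (repr (p x)) x.
Proof. by apply/presented_lie_eqP; rewrite reprK. Qed.

Definition pl_opp :=
  locked (fun x : presented_lie => p (LOpp (repr x))).
Definition pl_add :=
  locked (fun x y : presented_lie => p (LAdd (repr x) (repr y))).
Definition pl_scale :=
  locked (fun (a : F) (x : presented_lie) => p (LScale a (repr x))).
Definition pl_lbr :=
  locked (fun x y : presented_lie => p (LBr (repr x) (repr y))).

Lemma pl_oppE x : pl_opp (p x) = p (LOpp x).
Proof.
rewrite /pl_opp -lock; exact/presented_lie_eqP/lc_opp/presented_lie_reprP.
Qed.
Lemma pl_addE x y : pl_add (p x) (p y) = p (LAdd x y).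
Proof.
rewrite /pl_add -lock; apply/presented_lie_eqP/lc_add;
  apply: presented_lie_reprP.
Qed.
Lemma pl_scaleE a x : pl_scale a (p x) = p (LScale a x).
Proof.
rewrite /pl_scale -lock; exact/presented_lie_eqP/lc_scale/presented_lie_reprP.
Qed.
Lemma pl_lbrE x y : pl_lbr (p x) (p y) = p (LBr x y).
Proof.
rewrite /pl_lbr -lock; apply/presented_lie_eqP/lc_br;
  apply: presented_lie_reprP.
Qed.

Let pE := (pl_addE, pl_scaleE, pl_oppE, pl_lbrE).

Fact pl_addA : associative pl_add.
Proof.
move=> x y z; elim/quotW: x => x; elim/quotW: y => y; elim/quotW: z => z;
  rewrite !pE.
exact/presented_lie_eqP/lc_addA.
Qed.
Fact pl_addC : commutative pl_add.
Proof.
move=> x y; elim/quotW: x => x; elim/quotW: y => y; rewrite !pE;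
  exact/presented_lie_eqP/lc_addC.
Qed.
Fact pl_add0 : left_id (p LZero) pl_add.
Proof.
by move=> x; elim/quotW: x => x; rewrite !pE;
  apply/presented_lie_eqP/lc_add0.
Qed.
Fact pl_addN : left_inverse (p LZero) pl_opp pl_add.
Proof.
by move=> x; elim/quotW: x => x; rewrite !pE;
  apply/presented_lie_eqP/lc_addN.
Qed.

HB.instance Definition _ :=
  GRing.isZmodule.Build presented_lie pl_addA pl_addC pl_add0 pl_addN.

Fact pl_scaleA a b x : pl_scale a (pl_scale b x) = pl_scale (a * b) x.
Proof.
by elim/quotW: x => x; rewrite !pE; apply/presented_lie_eqP/lc_scaleA.
Qed.
Fact pl_scale1 : left_id 1 pl_scale.
Proof.
by move=> x; elim/quotW: x => x; rewrite !pE;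
  apply/presented_lie_eqP/lc_scale1.
Qed.
Fact pl_scaleDr : right_distributive pl_scale +%R.
Proof.
move=> a x y; elim/quotW: x => x; elim/quotW: y => y;
  rewrite /GRing.add /= !pE.
exact/presented_lie_eqP/lc_scaleDr.
Qed.
Fact pl_scaleDl x : {morph pl_scale^~ x : a b / a + b}.
Proof.
elim/quotW: x => x a b; rewrite [RHS]/GRing.add /= !pE.
exact/presented_lie_eqP/lc_scaleDl.
Qed.

HB.instance Definition _ := GRing.Zmodule_isLmodule.Build F presented_lie
  pl_scaleA pl_scale1 pl_scaleDr pl_scaleDl.

Fact pl_linE (a : F) x y : a *: p x + p y = p (LAdd (LScale a x) y).
Proof. by rewrite -pl_addE -pl_scaleE. Qed.

Fact pl_lbrPl (a : F) x y z :
  pl_lbr (a *: x + y) z = a *: pl_lbr x z + pl_lbr y z.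
Proof.
elim/quotW: x => x; elim/quotW: y => y; elim/quotW: z => z.
by rewrite pl_linE !pE pl_linE; apply/presented_lie_eqP/lc_brPl.
Qed.
Fact pl_lbrPr (a : F) x y z :
  pl_lbr x (a *: y + z) = a *: pl_lbr x y + pl_lbr x z.
Proof.
elim/quotW: x => x; elim/quotW: y => y; elim/quotW: z => z.
by rewrite pl_linE !pE pl_linE; apply/presented_lie_eqP/lc_brPr.
Qed.
Fact pl_lbrxx x : pl_lbr x x = 0.
Proof. by elim/quotW: x => x; rewrite pE; apply/presented_lie_eqP/lc_brxx. Qed.
Fact pl_jacobi x y z :
  pl_lbr x (pl_lbr y z) + pl_lbr y (pl_lbr z x) + pl_lbr z (pl_lbr x y) = 0.
Proof.
elim/quotW: x => x; elim/quotW: y => y; elim/quotW: z => z.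
by rewrite !pE /GRing.add /= !pE; apply/presented_lie_eqP/lc_jacobi.
Qed.

HB.instance Definition _ := Lmodule_isLieAlgebra.Build F presented_lie
  pl_lbrPl pl_lbrPr pl_lbrxx pl_jacobi.

Definition presented_lie_gen (g : G) : presented_lie := p (LGen g).

End PresentedLie.

Inductive alg_term (F G : Type) : Type :=
| AGen of G
| AZero
| AOne
| AOpp of alg_term F G
| AAdd of alg_term F G & alg_term F G
| AScale of F & alg_term F G
| AMul of alg_term F G & alg_term F G.

Arguments AGen {F G}.
Arguments AZero {F G}.
Arguments AOne {F G}.

HB.instance Definition _ F G := gen_eqMixin (alg_term F G).
HB.instance Definition _ F G := gen_choiceMixin (alg_term F G).

Inductive alg_cong (F : fieldType) (G : Type)
    (R : alg_term F G -> alg_term F G -> Prop) :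
    alg_term F G -> alg_term F G -> Prop :=
| ac_rel x y : R x y -> alg_cong R x y
| ac_refl x : alg_cong R x x
| ac_sym x y : alg_cong R x y -> alg_cong R y x
| ac_trans x y z : alg_cong R x y -> alg_cong R y z -> alg_cong R x z
| ac_opp x x' : alg_cong R x x' -> alg_cong R (AOpp x) (AOpp x')
| ac_add x x' y y' : alg_cong R x x' -> alg_cong R y y' ->
    alg_cong R (AAdd x y) (AAdd x' y')
| ac_scale a x x' : alg_cong R x x' -> alg_cong R (AScale a x) (AScale a x')
| ac_mul x x' y y' : alg_cong R x x' -> alg_cong R y y' ->
    alg_cong R (AMul x y) (AMul x' y')
| ac_addA x y z : alg_cong R (AAdd x (AAdd y z)) (AAdd (AAdd x y) z)
| ac_addC x y : alg_cong R (AAdd x y) (AAdd y x)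
| ac_add0 x : alg_cong R (AAdd AZero x) x
| ac_addN x : alg_cong R (AAdd (AOpp x) x) AZero
| ac_scaleA a b x : alg_cong R (AScale a (AScale b x)) (AScale (a * b) x)
| ac_scale1 x : alg_cong R (AScale 1 x) x
| ac_scaleDr a x y :
    alg_cong R (AScale a (AAdd x y)) (AAdd (AScale a x) (AScale a y))
| ac_scaleDl a b x :
    alg_cong R (AScale (a + b) x) (AAdd (AScale a x) (AScale b x))
| ac_mulA x y z : alg_cong R (AMul x (AMul y z)) (AMul (AMul x y) z)
| ac_mul1l x : alg_cong R (AMul AOne x) x
| ac_mul1r x : alg_cong R (AMul x AOne) x
| ac_mulDl x y z :
    alg_cong R (AMul (AAdd x y) z) (AAdd (AMul x z) (AMul y z))
| ac_mulDr x y z :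
    alg_cong R (AMul x (AAdd y z)) (AAdd (AMul x y) (AMul x z))
| ac_scaleAl a x y : alg_cong R (AScale a (AMul x y)) (AMul (AScale a x) y)
| ac_scaleAr a x y : alg_cong R (AScale a (AMul x y)) (AMul x (AScale a y)).

Section PresentedAlgebra.
Variables (F : fieldType) (G : Type) (R : alg_term F G -> alg_term F G -> Prop).

Definition alg_congb : rel (alg_term F G) := fun x y => `[< alg_cong R x y >].

Fact alg_congb_is_equiv : equiv_class_of alg_congb.
Proof.
split=> [x|x y|y x z].
- exact/asboolP/ac_refl.
- by apply/asboolP/asboolP; apply: ac_sym.
- by move=> /asboolP xy /asboolP yz; apply/asboolP; apply: ac_trans yz.
Qed.

Canonical alg_congb_equiv := EquivRelPack alg_congb_is_equiv.
Canonical alg_congb_encModRel := defaultEncModRel alg_congb.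

Definition presented_alg : Type := {eq_quot alg_congb}.
HB.instance Definition _ := Choice.on presented_alg.
HB.instance Definition _ : EqQuotient (alg_term F G) alg_congb presented_alg :=
  EqQuotient.on presented_alg.

Local Notation p := (\pi_presented_alg).

Lemma presented_alg_eqP x y : p x = p y <-> alg_cong R x y.
Proof. by split=> [/eqmodP/asboolP //|xy]; apply/eqmodP/asboolP. Qed.

Lemma presented_alg_reprP x : alg_cong R (repr (p x)) x.
Proof. by apply/presented_alg_eqP; rewrite reprK. Qed.

Definition pa_opp :=
  locked (fun x : presented_alg => p (AOpp (repr x))).
Definition pa_add :=
  locked (fun x y : presented_alg => p (AAdd (repr x) (repr y))).
Definition pa_scale :=
  locked (fun (a : F) (x : presented_alg) => p (AScale a (repr x))).
Definition pa_mul :=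
  locked (fun x y : presented_alg => p (AMul (repr x) (repr y))).

Lemma pa_oppE x : pa_opp (p x) = p (AOpp x).
Proof.
rewrite /pa_opp -lock; exact/presented_alg_eqP/ac_opp/presented_alg_reprP.
Qed.
Lemma pa_addE x y : pa_add (p x) (p y) = p (AAdd x y).
Proof.
rewrite /pa_add -lock; apply/presented_alg_eqP/ac_add;
  apply: presented_alg_reprP.
Qed.
Lemma pa_scaleE a x : pa_scale a (p x) = p (AScale a x).
Proof.
rewrite /pa_scale -lock; exact/presented_alg_eqP/ac_scale/presented_alg_reprP.
Qed.
Lemma pa_mulE x y : pa_mul (p x) (p y) = p (AMul x y).
Proof.
rewrite /pa_mul -lock; apply/presented_alg_eqP/ac_mul;
  apply: presented_alg_reprP.
Qed.

Let pE := (pa_addE, pa_scaleE, pa_oppE, pa_mulE).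

Fact pa_addA : associative pa_add.
Proof.
move=> x y z; elim/quotW: x => x; elim/quotW: y => y; elim/quotW: z => z;
  rewrite !pE.
exact/presented_alg_eqP/ac_addA.
Qed.
Fact pa_addC : commutative pa_add.
Proof.
move=> x y; elim/quotW: x => x; elim/quotW: y => y; rewrite !pE;
  exact/presented_alg_eqP/ac_addC.
Qed.
Fact pa_add0 : left_id (p AZero) pa_add.
Proof.
by move=> x; elim/quotW: x => x; rewrite !pE;
  apply/presented_alg_eqP/ac_add0.
Qed.
Fact pa_addN : left_inverse (p AZero) pa_opp pa_add.
Proof.
by move=> x; elim/quotW: x => x; rewrite !pE;
  apply/presented_alg_eqP/ac_addN.
Qed.

HB.instance Definition _ :=
  GRing.isZmodule.Build presented_alg pa_addA pa_addC pa_add0 pa_addN.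

Fact pa_mulA : associative pa_mul.
Proof.
move=> x y z; elim/quotW: x => x; elim/quotW: y => y; elim/quotW: z => z;
  rewrite !pE.
exact/presented_alg_eqP/ac_mulA.
Qed.
Fact pa_mul1l : left_id (p AOne) pa_mul.
Proof.
by move=> x; elim/quotW: x => x; rewrite !pE;
  apply/presented_alg_eqP/ac_mul1l.
Qed.
Fact pa_mul1r : right_id (p AOne) pa_mul.
Proof.
by move=> x; elim/quotW: x => x; rewrite !pE;
  apply/presented_alg_eqP/ac_mul1r.
Qed.
Fact pa_mulDl : left_distributive pa_mul +%R.
Proof.
move=> x y z; elim/quotW: x => x; elim/quotW: y => y; elim/quotW: z => z;
  rewrite /GRing.add /= !pE.
exact/presented_alg_eqP/ac_mulDl.
Qed.
Fact pa_mulDr : right_distributive pa_mul +%R.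
Proof.
move=> x y z; elim/quotW: x => x; elim/quotW: y => y; elim/quotW: z => z;
  rewrite /GRing.add /= !pE.
exact/presented_alg_eqP/ac_mulDr.
Qed.

HB.instance Definition _ := GRing.Zmodule_isPzRing.Build presented_alg
  pa_mulA pa_mul1l pa_mul1r pa_mulDl pa_mulDr.

Fact pa_scaleA a b x : pa_scale a (pa_scale b x) = pa_scale (a * b) x.
Proof.
by elim/quotW: x => x; rewrite !pE; apply/presented_alg_eqP/ac_scaleA.
Qed.
Fact pa_scale1 : left_id 1 pa_scale.
Proof.
by move=> x; elim/quotW: x => x; rewrite !pE;
  apply/presented_alg_eqP/ac_scale1.
Qed.
Fact pa_scaleDr : right_distributive pa_scale +%R.
Proof.
move=> a x y; elim/quotW: x => x; elim/quotW: y => y;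
  rewrite /GRing.add /= !pE.
exact/presented_alg_eqP/ac_scaleDr.
Qed.
Fact pa_scaleDl x : {morph pa_scale^~ x : a b / a + b}.
Proof.
elim/quotW: x => x a b; rewrite [RHS]/GRing.add /= !pE.
exact/presented_alg_eqP/ac_scaleDl.
Qed.

HB.instance Definition _ := GRing.Zmodule_isLmodule.Build F presented_alg
  pa_scaleA pa_scale1 pa_scaleDr pa_scaleDl.

Fact pa_scaleAl (a : F) (x y : presented_alg) : a *: (x * y) = (a *: x) * y.
Proof.
elim/quotW: x => x; elim/quotW: y => y.
rewrite /GRing.scale /GRing.mul /= !pE; exact/presented_alg_eqP/ac_scaleAl.
Qed.
Fact pa_scaleAr (a : F) (x y : presented_alg) : a *: (x * y) = x * (a *: y).
Proof.
elim/quotW: x => x; elim/quotW: y => y.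
rewrite /GRing.scale /GRing.mul /= !pE; exact/presented_alg_eqP/ac_scaleAr.
Qed.

HB.instance Definition _ := Assoc_isLieAlgebra.Build F presented_alg
  pa_scaleAl pa_scaleAr.

Definition presented_alg_gen (g : G) : presented_alg := p (AGen g).

End PresentedAlgebra.


Definition gl (F : fieldType) (W : lmodType F) : Type := {linear W -> W}.

Definition gl_fun (F : fieldType) (W : lmodType F) (f : gl W) : W -> W :=
  GRing.Linear.sort f.
Coercion gl_fun : gl >-> Funclass.

Section GeneralLinear.
Variables (F : fieldType) (W : lmodType F).
Implicit Types f g h : gl W.

HB.instance Definition _ := gen_eqMixin (gl W).
HB.instance Definition _ := gen_choiceMixin (gl W).

Definition gl_of (f : W -> W) (lin_f : linear f) : gl W :=
  HB.pack_for {linear W -> W} f (GRing.isLinear.Build F W W *:%R f lin_f).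

Lemma gl_ofE (f : W -> W) (lin_f : linear f) w : gl_of lin_f w = f w.
Proof. by []. Qed.

Lemma gl_ext f g : (forall w, f w = g w) -> f = g.
Proof.
case: f g => [f [[cf] [df]]] [g [[cg] [dg]]] /= fg.
have {}fg : f = g by apply: funext.
subst g; congr (GRing.Linear.Pack (GRing.Linear.Class _ _)).
- by congr Algebra.isNmodMorphism.Axioms_; apply: Prop_irrelevance.
- by congr GRing.isScalable.Axioms_; apply: Prop_irrelevance.
Qed.

Lemma gl_linear f : linear f.
Proof. by move=> a u v; rewrite /gl_fun linearP. Qed.

Fact gl_zero_linear : linear (fun _ : W => 0 : W).
Proof. by move=> a u v; rewrite scaler0 addr0. Qed.
Fact gl_opp_linear f : linear (fun w => - f w).
Proof. by move=> a u v; rewrite gl_linear opprD scalerN. Qed.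
Fact gl_add_linear f g : linear (fun w => f w + g w).
Proof. by move=> a u v; rewrite !gl_linear scalerDr addrACA. Qed.
Fact gl_scale_linear a f : linear (fun w => a *: f w).
Proof. by move=> b u v; rewrite gl_linear scalerDr !scalerA mulrC. Qed.
Fact gl_one_linear : linear (fun w : W => w).
Proof. by []. Qed.
Fact gl_mul_linear f g : linear (fun w => f (g w)).
Proof. by move=> a u v; rewrite !gl_linear. Qed.

Definition gl_zero : gl W := gl_of gl_zero_linear.
Definition gl_opp f : gl W := gl_of (gl_opp_linear f).
Definition gl_add f g : gl W := gl_of (gl_add_linear f g).
Definition gl_scale a f : gl W := gl_of (gl_scale_linear a f).
Definition gl_one : gl W := gl_of gl_one_linear.
Definition gl_mul f g : gl W := gl_of (gl_mul_linear f g).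

Fact gl_addA : associative gl_add.
Proof. by move=> f g h; apply: gl_ext => w; exact: addrA. Qed.
Fact gl_addC : commutative gl_add.
Proof. by move=> f g; apply: gl_ext => w; exact: addrC. Qed.
Fact gl_add0 : left_id gl_zero gl_add.
Proof. by move=> f; apply: gl_ext => w; exact: add0r. Qed.
Fact gl_addN : left_inverse gl_zero gl_opp gl_add.
Proof. by move=> f; apply: gl_ext => w; exact: addNr. Qed.

HB.instance Definition _ :=
  GRing.isZmodule.Build (gl W) gl_addA gl_addC gl_add0 gl_addN.

Fact gl_mulA : associative gl_mul.
Proof. by move=> f g h; apply: gl_ext. Qed.
Fact gl_mul1l : left_id gl_one gl_mul.
Proof. by move=> f; apply: gl_ext. Qed.
Fact gl_mul1r : right_id gl_one gl_mul.
Proof. by move=> f; apply: gl_ext. Qed.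
Fact gl_mulDl : left_distributive gl_mul +%R.
Proof. by move=> f g h; apply: gl_ext. Qed.
Fact gl_mulDr : right_distributive gl_mul +%R.
Proof. by move=> f g h; apply: gl_ext => w; exact: (raddfD f). Qed.

HB.instance Definition _ := GRing.Zmodule_isPzRing.Build (gl W)
  gl_mulA gl_mul1l gl_mul1r gl_mulDl gl_mulDr.

Fact gl_scaleA a b f : gl_scale a (gl_scale b f) = gl_scale (a * b) f.
Proof. by apply: gl_ext => w; exact: scalerA. Qed.
Fact gl_scale1 : left_id 1 gl_scale.
Proof. by move=> f; apply: gl_ext => w; exact: scale1r. Qed.
Fact gl_scaleDr : right_distributive gl_scale +%R.
Proof. by move=> a f g; apply: gl_ext => w; exact: scalerDr. Qed.
Fact gl_scaleDl f : {morph gl_scale^~ f : a b / a + b}.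
Proof. by move=> a b; apply: gl_ext => w; exact: scalerDl. Qed.

HB.instance Definition _ := GRing.Zmodule_isLmodule.Build F (gl W)
  gl_scaleA gl_scale1 gl_scaleDr gl_scaleDl.

Fact gl_scaleAl (a : F) f g : a *: (f * g) = (a *: f) * g.
Proof. by apply: gl_ext. Qed.
Fact gl_scaleAr (a : F) f g : a *: (f * g) = f * (a *: g).
Proof. by apply: gl_ext => w; rewrite [RHS](linearZ_LR f). Qed.

HB.instance Definition _ := Assoc_isLieAlgebra.Build F (gl W)
  gl_scaleAl gl_scaleAr.

End GeneralLinear.

Definition simply_laced_gcm (V : Type) (A : V -> V -> int) : Prop :=
  (forall i, A i i = 2) /\
  (forall i j, i <> j -> A i j = A j i /\ (A i j = 0 \/ A i j = -1)).

Record labeled_graph (F : fieldType) (V : Type) := LabeledGraph {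
  adj : V -> V -> Prop;
  label : V -> F;
  adj_sym : forall x y, adj x y -> adj y x;
  adj_irrefl : forall x, ~ adj x x
}.

Section GcmGraph.
Variables (F : fieldType) (V : Type) (A : V -> V -> int).
Variable slA : simply_laced_gcm A.

Definition gcm_adj (x y : V) : Prop := x <> y /\ A x y <> 0.

Fact gcm_adj_sym x y : gcm_adj x y -> gcm_adj y x.
Proof.
move=> [xy Axy]; have [AC _] := slA.2 x y xy.
by split; [move=> yx; apply: xy | rewrite -AC].
Qed.

Fact gcm_adj_irrefl x : ~ gcm_adj x x.
Proof. by case. Qed.

Definition gcm_graph : labeled_graph F V :=
  LabeledGraph (fun _ => -1) gcm_adj_sym gcm_adj_irrefl.

End GcmGraph.

Inductive km_index (V : Type) : Type := KM_e of V | KM_f of V | KM_h of V.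

Section KacMoody.
Variables (F : fieldType) (V : Type) (A : V -> V -> int).

Local Notation e i := (LGen (KM_e i)).
Local Notation f i := (LGen (KM_f i)).
Local Notation h i := (LGen (KM_h i)).

Inductive km_rel :
    lie_term F (km_index V) -> lie_term F (km_index V) -> Prop :=
| km_hh i j : km_rel (LBr (h i) (h j)) LZero
| km_he i j : km_rel (LBr (h i) (e j)) (LScale (A i j)%:~R (e j))
| km_hf i j : km_rel (LBr (h i) (f j)) (LScale (- (A i j)%:~R) (f j))
| km_ef i : km_rel (LBr (e i) (f i)) (h i)
| km_ef0 i j : i <> j -> km_rel (LBr (e i) (f j)) LZero
| km_ee0 i j : i <> j -> A i j = 0 -> km_rel (LBr (e i) (e j)) LZero
| km_ff0 i j : i <> j -> A i j = 0 -> km_rel (LBr (f i) (f j)) LZero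
| km_eee0 i j : i <> j -> km_rel (LBr (e i) (LBr (e i) (e j))) LZero
| km_fff0 i j : i <> j -> km_rel (LBr (f i) (LBr (f i) (f j))) LZero.

Definition kac_moody : Type := presented_lie km_rel.
HB.instance Definition _ := LieAlgebra.on kac_moody.

Definition km_e (i : V) : kac_moody := presented_lie_gen km_rel (KM_e i).
Definition km_f (i : V) : kac_moody := presented_lie_gen km_rel (KM_f i).

Definition compact_gens : set kac_moody := range (fun i => km_e i - km_f i).

Definition compact_subalgebra : Type := generated_subalgebra compact_gens.
HB.instance Definition _ := LieAlgebra.on compact_subalgebra.

Definition compact_gen (i : V) : compact_subalgebra :=
  span_gen (imageT (fun i => km_e i - km_f i) i).

End KacMoody.

Section GraphAlgebra.
Variables (F : fieldType) (V : Type) (Gamma : labeled_graph F V).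

Local Notation g v := (AGen v).

Inductive clifford_rel : alg_term F V -> alg_term F V -> Prop :=
| cl_sq v : clifford_rel (AMul (g v) (g v)) (AScale (label Gamma v) AOne)
| cl_adj v w : adj Gamma v w ->
    clifford_rel (AAdd (AMul (g v) (g w)) (AMul (g w) (g v))) AZero
| cl_nadj v w : ~ adj Gamma v w ->
    clifford_rel (AAdd (AMul (g v) (g w)) (AOpp (AMul (g w) (g v)))) AZero.

Definition graph_algebra : Type := presented_alg clifford_rel.
HB.instance Definition _ := GRing.PzRing.on graph_algebra.
HB.instance Definition _ := LieAlgebra.on graph_algebra.

Definition graph_algebra_gen (v : V) : graph_algebra :=
  presented_alg_gen clifford_rel v.

Definition graph_lie : Type :=
  generated_subalgebra (range graph_algebra_gen).
HB.instance Definition _ := LieAlgebra.on graph_lie.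

End GraphAlgebra.

Definition is_generalized_spin_rep (F : fieldType) (V : Type)
    (A : V -> V -> int) (W : lmodType F)
    (phi : compact_subalgebra F A -> gl W) : Prop :=
  lie_hom phi /\ forall i, phi (compact_gen F A i) ^+ 2 = -1.

(* Main.v *)
Require Import Defs.
From HB Require Import structures.
From mathcomp Require Import all_boot all_order all_algebra.
From mathcomp Require Import boolp classical_sets functions.
From mathcomp Require Import ring.

Set Implicit Arguments.
Unset Strict Implicit.
Unset Printing Implicit Defensive.

Import GRing.Theory.
Local Open Scope ring_scope.
Local Open Scope quotient_scope.

(** The elements [x_i = e_i - f_i] satisfy the Berman relations
    [⁅x_i, x_j⁆ = 0] for [a_ij = 0] and [⁅x_i, ⁅x_i, x_j⁆⁆ = - x_j] for
    [a_ij = -1], and so do the generators of the graph algebra.  What has to be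
    shown is that no other relation between the [x_i] holds in the Kac-Moody
    algebra: any operators [c_i] on a vector space [S] that satisfy the Berman
    relations extend to a representation of the compact subalgebra on [S]
    ([compact_subalgebra_universal]).

    For this, a Kac-Moody module containing [S] as a module of the compact
    subalgebra is built.  Start from [S]-valued functions on the words in the
    simple roots: the dual of the Verma module of highest weight 0 for the
    algebra without Serre relations, twisted by the involution exchanging the
    [e_i] and the [f_i], so that [e_i] shifts the argument, [h_i] is diagonal,
    and [f_i] is forced by the value 0 at the empty word together with
    [⁅e_j, f_i⁆ = d_ij h_i].  In this module an operator commuting with all the
    [e_k] and vanishing at the empty word is zero ([verma_operator_eq0]), and
    this gives the Serre relations for the [f_i].

    The Serre relations for the [e_i] hold only on a submodule.  The Iwasawa
    decomposition suggests which one: a function is determined by its value [s]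
    at the empty word and the requirement that [x_i] carry the function of [s]
    to the function of [c_i s].  This is the map [intertwiner].  A Serre element
    in the [e_i] is, up to sign, the one in the [f_i] plus a Berman relator in
    the [x_i] ([compact_bracket], [compact_double_bracket]), so it kills the
    image of [S]; since it commutes with the [f_i] and is a weight vector, it kills
    everything obtained from that image by the [f_i] and [h_i], which is also
    stable under the [e_i].  Thus the Kac-Moody algebra acts on this submodule
    [spin_module], and an element of the compact subalgebra maps the function
    of [s] to the function of some [rho s]; [rho] is the desired
    representation.

    Finally take [S] to be the graph algebra and [c_i] the left multiplication
    by the [i]-th generator.  This is a generalized spin representation, it
    takes values in left multiplications by elements of the Lie algebra of the
    graph, and these are all reached, so the first isomorphism theorem
    applies. *)

(** * Lie algebras and their homomorphisms *)

Lemma char0_two_neq0 (F : fieldType) : [pchar F] =i pred0 -> (2%:R : F) != 0.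
Proof. by move=> charF0; rewrite ((pcharf0P F).1 charF0 2). Qed.

Section LieIdentities.
Variables (F : fieldType) (L : lieAlgType F).
Implicit Types (a : F) (x y z : L).

Lemma lbrZl a x y : ⁅a *: x, y⁆ = a *: ⁅x, y⁆.
Proof.
have lbr0 z : ⁅0 : L, z⁆ = 0.
  by have := lbrPl (-1) (0 : L) 0 z; rewrite scaler0 addr0 scaleN1r addNr.
by have := lbrPl a x 0 y; rewrite !addr0 lbr0 addr0.
Qed.

Lemma lbrZr a x y : ⁅x, a *: y⁆ = a *: ⁅x, y⁆.
Proof. by rewrite lbrC lbrZl -scalerN -lbrC. Qed.

Lemma lbr0r x : ⁅x, 0⁆ = 0.
Proof. by have := lbrZr 0 x 0; rewrite !scale0r. Qed.

Lemma lbrNr x y : ⁅x, - y⁆ = - ⁅x, y⁆.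
Proof. by rewrite -scaleN1r lbrZr scaleN1r. Qed.

Lemma lbrNl x y : ⁅- x, y⁆ = - ⁅x, y⁆.
Proof. by rewrite -scaleN1r lbrZl scaleN1r. Qed.

Lemma lbr_leibniz x y z : ⁅x, ⁅y, z⁆⁆ = ⁅⁅x, y⁆, z⁆ + ⁅y, ⁅x, z⁆⁆.
Proof.
apply/eqP; rewrite -subr_eq0; apply/eqP; rewrite -(lbr_jacobi x y z).
rewrite opprD addrA (addrAC _ (- _)) [⁅⁅x, y⁆, z⁆]lbrC opprK.
by rewrite (lbrC z x) lbrNr addrAC.
Qed.

End LieIdentities.

Section LieHom.
Variables (F : fieldType) (L M : lieAlgType F) (f : L -> M).
Hypothesis fH : lie_hom f.

Lemma lie_hom0 : f 0 = 0.
Proof. by have := fH.1 (-1) 0 0; rewrite scaler0 addr0 scaleN1r addNr. Qed.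

Lemma lie_homD x y : f (x + y) = f x + f y.
Proof. by have := fH.1 1 x y; rewrite !scale1r. Qed.

Lemma lie_homN x : f (- x) = - f x.
Proof. by have := fH.1 (-1) x 0; rewrite lie_hom0 !addr0 !scaleN1r. Qed.

Lemma lie_homB x y : f (x - y) = f x - f y.
Proof. by rewrite lie_homD lie_homN. Qed.

Fact ker_is_lie_ideal : is_lie_ideal (fun x => f x = 0).
Proof.
split; first exact: lie_hom0.
- by move=> a x y fx fy; rewrite fH.1 fx fy scaler0 addr0.
- by move=> x y fy; rewrite fH.2 fy lbr0r.
Qed.

Definition lie_kernel : lie_ideal L := LieIdeal ker_is_lie_ideal.

Lemma lie_first_isomorphism :
  (forall y, exists x, f x = y) -> lie_isomorphic (lie_quot lie_kernel) M.
Proof.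
move=> fsurj; pose fbar (q : lie_quot lie_kernel) := f (repr q).
have fbarE x : fbar (\pi x) = f x.
  by have /= := lie_quot_reprP lie_kernel x; rewrite lie_homB => /subr0_eq.
exists fbar; split; first split.
- move=> a x y; elim/quotW: x => x; elim/quotW: y => y.
  by rewrite -(pi_lq_lin lie_kernel) !fbarE fH.1.
- move=> x y; elim/quotW: x => x; elim/quotW: y => y.
  by rewrite !fbarE -fH.2 -fbarE; congr fbar; exact: lq_lbrE.
have [g fg] := choice fsurj.
exists (fun y => \pi_(lie_quot lie_kernel) (g y)) => [q|y]; last first.
  by rewrite fbarE.
elim/quotW: q => x; apply/(lie_quot_eqP lie_kernel).
by rewrite /= lie_homB fg fbarE subrr.
Qed.

End LieHom.

Section PresentedLieUniversal.
Variables (F : fieldType) (G : Type) (R : lie_term F G -> lie_term F G -> Prop).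
Variables (M : lieAlgType F) (g : G -> M).

Fixpoint lie_eval (t : lie_term F G) : M :=
  match t with
  | LGen a => g a
  | LZero => 0
  | LOpp t => - lie_eval t
  | LAdd s t => lie_eval s + lie_eval t
  | LScale a t => a *: lie_eval t
  | LBr s t => ⁅lie_eval s, lie_eval t⁆
  end.

Hypothesis gR : forall s t, R s t -> lie_eval s = lie_eval t.

Lemma lie_eval_cong s t : lie_cong R s t -> lie_eval s = lie_eval t.
Proof.
elim=> {s t} //=.
- by move=> s t t' _ ->.
- by move=> s s' _ ->.
- by move=> s s' t t' _ -> _ ->.
- by move=> a s s' _ ->.
- by move=> s s' t t' _ -> _ ->.
- by move=> s t u; rewrite addrA.
- by move=> s t; rewrite addrC.
- by move=> s; rewrite add0r.
- by move=> s; rewrite addNr.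
- by move=> a b s; rewrite scalerA.
- by move=> s; rewrite scale1r.
- by move=> a s t; rewrite scalerDr.
- by move=> a b s; rewrite scalerDl.
- by move=> a s t u; rewrite lbrPl.
- by move=> a s t u; rewrite lbrPr.
- by move=> s; rewrite lbrxx.
- by move=> s t u; rewrite lbr_jacobi.
Qed.

(** A presented Lie algebra maps to every Lie algebra in which the images of the
    generators satisfy the relations: the congruence contains only what holds
    in all Lie algebras. *)
Lemma presented_lie_universal : exists f : presented_lie R -> M,
  lie_hom f /\ forall a, f (presented_lie_gen R a) = g a.
Proof.
pose f (x : presented_lie R) := lie_eval (repr x).
have fE t : f (\pi t) = lie_eval t.
  exact/lie_eval_cong/presented_lie_reprP.
exists f; split; last by move=> a; exact: fE.
split=> x y.
- move=> z; elim/quotW: y => y; elim/quotW: z => z.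
  by rewrite pl_linE !fE.
- elim/quotW: x => x; elim/quotW: y => y; rewrite !fE.
  by rewrite -[RHS]/(lie_eval (LBr x y)) -fE; congr f; exact: pl_lbrE.
Qed.

End PresentedLieUniversal.

Section GeneratedSubalgebraTheory.
Variables (F : fieldType) (L : lieAlgType F) (S : set L).

Lemma generated_subalgebra_ind (P : generated_subalgebra S -> Prop) :
    (forall x (Sx : S x), P (span_gen Sx)) ->
    (forall (a : F) x y, P x -> P y -> P (a *: x + y)) ->
    (forall x y, P x -> P y -> P ⁅x, y⁆) ->
  P 0 -> forall x, P x.
Proof.
move=> Pgen Plin Pbr P0 [x Sx].
suff [z Pz zx] : exists2 z, P z & val z = x.
  by have <- : z = exist _ x Sx by apply: val_inj.
move/asboolP: Sx => /(_ (fun y => exists2 z, P z & val z = y)).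
apply; split; first split.
- by exists 0.
- by move=> a _ _ [y Py <-] [z Pz <-]; exists (a *: y + z) => //; apply: Plin.
- by move=> _ _ [y Py <-] [z Pz <-]; exists ⁅y, z⁆ => //; apply: Pbr.
- by move=> y Sy; exists (span_gen Sy).
Qed.

End GeneratedSubalgebraTheory.

(** * Endomorphism algebras *)

Section GlTheory.
Variables (F : fieldType) (W : lmodType F).
Implicit Types (f g : gl W) (w : W).

Lemma gl_addE f g w : gl_fun (f + g) w = f w + g w. Proof. by []. Qed.
Lemma gl_oppE f w : gl_fun (- f) w = - f w. Proof. by []. Qed.
Lemma gl_scaleE (a : F) f w : gl_fun (a *: f) w = a *: f w. Proof. by []. Qed.
Lemma gl_mulE f g w : gl_fun (f * g) w = f (g w). Proof. by []. Qed.
Lemma gl_0E w : gl_fun (0 : gl W) w = 0. Proof. by []. Qed.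

Lemma gl_lbrE f g w : gl_fun ⁅f, g⁆ w = (2%:R : F)^-1 *: (f (g w) - g (f w)).
Proof. by []. Qed.

Lemma gl_fun0 f : f 0 = 0. Proof. exact: raddf0. Qed.

(** The factor 2 comes from the normalization of the bracket. *)
Lemma gl_swap f g w :
  (2%:R : F) != 0 -> f (g w) = g (f w) + 2%:R *: gl_fun ⁅f, g⁆ w.
Proof. by move=> n0; rewrite gl_lbrE scalerA divff // scale1r addrC subrK. Qed.

End GlTheory.

Section Equivariance.
Variables (F : fieldType) (W U : lmodType F) (j : W -> U).
Hypothesis j_linear : linear j.

Definition equivariant (f : gl W) (g : gl U) : Prop :=
  forall w, g (j w) = j (f w).

Let j0 : j 0 = 0.
Proof. by have := j_linear (-1) 0 0; rewrite scaler0 addr0 scaleN1r addNr. Qed.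

Lemma equivariant0 : equivariant 0 0.
Proof. by move=> w; rewrite gl_0E j0. Qed.

Lemma equivariant_lin a f f' g g' : equivariant f g -> equivariant f' g' ->
  equivariant (a *: f + f') (a *: g + g').
Proof.
by move=> fg fg' w; rewrite !gl_addE !gl_scaleE fg fg' j_linear.
Qed.

Lemma equivariantZ a f g : equivariant f g -> equivariant (a *: f) (a *: g).
Proof.
move=> fg w; rewrite -[a *: g]addr0 -[a *: f]addr0.
exact: equivariant_lin fg equivariant0 w.
Qed.

Lemma equivariant_lbr f f' g g' :
  equivariant f g -> equivariant f' g' -> equivariant ⁅f, f'⁆ ⁅g, g'⁆.
Proof.
move=> fg fg' w; rewrite !gl_lbrE fg fg' fg fg'.
have jB u v : j (u - v) = j u - j v.
  by rewrite addrC -scaleN1r j_linear scaleN1r addrC.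
have jZ a u : j (a *: u) = a *: j u.
  by have := j_linear a u 0; rewrite j0 !addr0.
by rewrite jZ jB.
Qed.

End Equivariance.

(** * Serre elements and the Berman relations *)

Section SerreElements.
Variables (F : fieldType) (L : lieAlgType F) (V : Type) (A : V -> V -> int).
Hypothesis slA : simply_laced_gcm A.
Implicit Types e f h x : V -> L.

(** The relations between simple root vectors and simple coroots that do not
    involve two root vectors of the same sign. *)
Definition chevalley_relations e f h : Prop :=
  [/\ forall i j, ⁅h i, e j⁆ = (A i j)%:~R *: e j,
      forall i j, ⁅h i, f j⁆ = - (A i j)%:~R *: f j,
      forall i, ⁅e i, f i⁆ = h i
    & forall i j, i <> j -> ⁅e i, f j⁆ = 0].

(** The two cases are disjoint; for [A i j = 0] the cubic relation follows from
    the quadratic one. *)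
Inductive serre_element x : L -> Prop :=
| serre_nadj i j : i <> j -> A i j = 0 -> serre_element x ⁅x i, x j⁆
| serre_adj i j :
    i <> j -> A i j = -1 -> serre_element x ⁅x i, ⁅x i, x j⁆⁆.

Lemma chevalley_involution e f h :
  chevalley_relations e f h -> chevalley_relations f e (fun i => - h i).
Proof.
case=> he hf ef ef0; split=> [i j|i j|i|i j ij].
- by rewrite lbrNl hf scaleNr opprK.
- by rewrite lbrNl he scaleNr.
- by rewrite lbrC ef.
- by rewrite lbrC ef0 ?oppr0 // => ji; apply: ij.
Qed.

(** The classical fact that makes the Serre relations compatible with the
    triangular decomposition.  For [A i j = -1], bracketing with [e i] turns
    [⁅f i, ⁅f i, f j⁆⁆] into [- (A i i + 2 A i j) = 0] times [⁅f i, f j⁆], and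
    bracketing with [e j] turns it into a multiple of [⁅f i, f i⁆]. *)
Lemma serre_element_comm e f h z k :
  chevalley_relations e f h -> serre_element f z -> ⁅e k, z⁆ = 0.
Proof.
case=> _ hf ef ef0.
have eff_i i j : i <> j -> ⁅e i, ⁅f i, f j⁆⁆ = - (A i j)%:~R *: f j.
  by move=> ij; rewrite lbr_leibniz ef hf ef0 // lbr0r addr0.
have eff_j i j : i <> j -> ⁅e j, ⁅f i, f j⁆⁆ = (A i j)%:~R *: f i.
  move=> ij; rewrite lbr_leibniz ef0 1?lbrC ?lbr0r ?oppr0 ?add0r;
    last exact/nesym.
  by rewrite ef lbrC hf scaleNr opprK (slA.2 i j ij).1.
have eff0 i j : k <> i -> k <> j -> ⁅e k, ⁅f i, f j⁆⁆ = 0.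
  by move=> ki kj; rewrite lbr_leibniz !ef0 // lbr0r lbrC lbr0r oppr0 addr0.
case=> i j ij Aij.
- have [->|ki] := pselect (k = i); first by rewrite eff_i // Aij oppr0 scale0r.
  have [->|kj] := pselect (k = j); first by rewrite eff_j // Aij scale0r.
  exact: eff0.
have [->|ki] := pselect (k = i).
  rewrite lbr_leibniz ef eff_i // Aij lbr_leibniz !hf Aij slA.1 lbrZl lbrZr.
  by rewrite opprK !scale1r scaleNr -addrA -mulr2n -scaler_nat addNr.
rewrite lbr_leibniz ef0 // lbrC lbr0r oppr0 add0r.
have [->|kj] := pselect (k = j); last by rewrite eff0 ?lbr0r.
by rewrite eff_j // lbrZr lbrxx scaler0.
Qed.

(** By the Jacobi identity the other relations force [f j] to have the right
    weight up to an element commuting with all the [e k]; in the Verma module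
    below this leaves no room for an error. *)
Lemma cartan_lowering_comm e f h i j k :
    (forall i j, ⁅h i, h j⁆ = 0) ->
    (forall i j, ⁅h i, e j⁆ = (A i j)%:~R *: e j) ->
    (forall i, ⁅e i, f i⁆ = h i) ->
    (forall i j, i <> j -> ⁅e i, f j⁆ = 0) ->
  ⁅e k, ⁅h i, f j⁆ - (- (A i j)%:~R *: f j)⁆ = 0.
Proof.
move=> hh he ef ef0.
rewrite scaleNr opprK lbrDr lbrZr lbr_leibniz (lbrC (e k)) he lbrNl lbrZl.
have [->|kj] := pselect (k = j); first by rewrite ef hh addr0 addNr.
by rewrite ef0 // lbr0r !scaler0 oppr0 !addr0.
Qed.

Lemma serre_element_weight e f h z k :
  chevalley_relations e f h -> serre_element e z ->
  exists a : F, ⁅h k, z⁆ = a *: z.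
Proof.
case=> he _ _ _.
have hee i j : ⁅h k, ⁅e i, e j⁆⁆ =
    ((A k i)%:~R + (A k j)%:~R : F) *: ⁅e i, e j⁆.
  by rewrite lbr_leibniz !he lbrZl lbrZr -scalerDl.
case=> i j _ _; first by exists ((A k i)%:~R + (A k j)%:~R); apply: hee.
exists ((A k i)%:~R + ((A k i)%:~R + (A k j)%:~R)).
by rewrite lbr_leibniz he hee lbrZl lbrZr -scalerDl.
Qed.

Definition berman_relations x : Prop := forall i j, i <> j ->
  (A i j = 0 -> ⁅x i, x j⁆ = 0) /\
  (A i j = -1 -> ⁅x i, ⁅x i, x j⁆⁆ = - x j).

(** Brackets of the [e i - f i] are computed modulo the Chevalley relations; the
    mixed terms either vanish or contract to a multiple of a generator, so a
    Serre element in the [e i] is, up to sign, the one in the [f i] plus a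
    Berman relator. *)
Lemma compact_bracket e f h i j : chevalley_relations e f h -> i <> j ->
  ⁅e i - f i, e j - f j⁆ = ⁅e i, e j⁆ + ⁅f i, f j⁆.
Proof.
case=> _ _ _ ef0 ij; rewrite lbrBr lbrDl lbrNl lbrDl lbrNl (lbrC (f i)).
by rewrite !ef0 ?oppr0 ?opprK ?subr0 ?add0r ?addr0 ?opprK //; apply/nesym.
Qed.

Lemma compact_double_bracket e f h i j : chevalley_relations e f h -> i <> j ->
  ⁅e i - f i, ⁅e i - f i, e j - f j⁆⁆ =
  ⁅e i, ⁅e i, e j⁆⁆ - ⁅f i, ⁅f i, f j⁆⁆ + (A i j)%:~R *: (e j - f j).
Proof.
move=> efh ij; rewrite (compact_bracket efh ij).
have [he hf ef ef0] := efh.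
have eff : ⁅e i, ⁅f i, f j⁆⁆ = - (A i j)%:~R *: f j.
  by rewrite lbr_leibniz ef hf ef0 // lbr0r addr0.
have fee : ⁅f i, ⁅e i, e j⁆⁆ = - (A i j)%:~R *: e j.
  rewrite lbr_leibniz (lbrC (f i) (e i)) ef lbrNl he (lbrC (f i)) ef0;
    last exact/nesym.
  by rewrite oppr0 lbr0r addr0 scaleNr.
rewrite lbrDl lbrNl !lbrDr eff fee !scaleNr opprD opprK scalerBr.
by rewrite [_ - ⁅f i, _⁆]addrC addrACA [- _ + _]addrC.
Qed.

End SerreElements.

(** * The contragredient Verma module without Serre relations *)

Section ContragredientVerma.
Variables (F : fieldType) (V : Type) (A : V -> V -> int) (S : lmodType F).
Hypothesis charF0 : [pchar F] =i pred0.
Hypothesis slA : simply_laced_gcm A.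

Local Notation dual_verma := (seq V -> S).
Implicit Types (phi psi : dual_verma) (w : seq V).

Let two_neq0 : (2%:R : F) != 0 := char0_two_neq0 charF0.

(** The eigenvalue of [h_i] on the monomial [f_w] applied to a highest weight
    vector of weight 0, doubled because of the factor 1/2 in the bracket. *)
Definition verma_weight (i : V) w : F := \sum_(j <- w) - 2%:R * (A i j)%:~R.

(** With [phi] extended linearly to the Verma module, whose basis consists of
    the monomials [f_w] applied to the highest weight vector, this is the value
    of [phi] at [e_i f_w]; the recursion moves [e_i] past the first letter. *)
Fixpoint lowering_fun (i : V) phi w : S :=
  if w is j :: w' then
    lowering_fun i (fun u => phi (j :: u)) w' +
      (if `[< i = j >] then 2%:R * verma_weight i w' else 0) *: phi w'
  else 0.

Fact raising_linear i : linear (fun phi w => phi (i :: w) : S).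
Proof. by []. Qed.

Fact cartan_linear i : linear (fun phi w => verma_weight i w *: phi w).
Proof.
move=> a phi psi; apply/funext => w.
rewrite -[RHS]/(a *: (verma_weight i w *: phi w) + verma_weight i w *: psi w).
by rewrite scalerDr !scalerA [a * _]mulrC.
Qed.

Fact lowering_linear i : linear (lowering_fun i).
Proof.
move=> a phi psi; apply/funext => w.
rewrite -[RHS]/(a *: lowering_fun i phi w + lowering_fun i psi w).
elim: w phi psi => [|j w IHw] phi psi /=; first by rewrite scaler0 addr0.
rewrite -[X in lowering_fun i X w]/(a *: (fun u => phi (j :: u)) +
  (fun u => psi (j :: u))) IHw -[(a *: phi + psi) w]/(a *: phi w + psi w).
by rewrite !scalerDr !scalerA addrACA [_ * a]mulrC.
Qed.

Definition raising i : gl dual_verma := gl_of (raising_linear i).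
Definition cartan i : gl dual_verma := gl_of (cartan_linear i).
Definition lowering i : gl dual_verma := gl_of (lowering_linear i).

Lemma raisingE i phi w : raising i phi w = phi (i :: w). Proof. by []. Qed.

Lemma cartanE i phi w : cartan i phi w = verma_weight i w *: phi w.
Proof. by []. Qed.

Lemma lowering_nil i phi : lowering i phi [::] = 0.
Proof. by []. Qed.

Lemma cartan_nil i phi : cartan i phi [::] = 0.
Proof. by rewrite cartanE /verma_weight big_nil scale0r. Qed.

Lemma lowering_cons i phi j w : lowering i phi (j :: w) =
  lowering i (raising j phi) w +
    (if `[< i = j >] then 2%:R * verma_weight i w else 0) *: phi w.
Proof. by []. Qed.

(** An operator commuting with the shifts is determined by its values at the
    empty word; dually, an endomorphism of a Verma module is determined by its
    value on the highest weight vector. *)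
Lemma verma_operator_eq0 (X : gl dual_verma) :
    (forall phi, X phi [::] = 0) -> (forall k, ⁅raising k, X⁆ = 0) -> X = 0.
Proof.
move=> X0 EX; apply: gl_ext => phi; apply/funext => w.
elim: w phi => [|k w IHw] phi; first exact: X0.
have -> : X phi (k :: w) = X (raising k phi) w.
  by rewrite -raisingE (gl_swap _ _ _ two_neq0) EX gl_0E scaler0 addr0.
by rewrite IHw.
Qed.

Lemma verma_raising_lowering i j :
  ⁅raising i, lowering j⁆ = if `[< j = i >] then cartan j else 0.
Proof.
apply: gl_ext => phi; apply/funext => w.
rewrite gl_lbrE -[LHS]/(2%:R^-1 *: (raising i (lowering j phi) w -
  lowering j (raising i phi) w)).
rewrite raisingE lowering_cons addrC addKr; case: asboolP => _.
  by rewrite scalerA mulKf.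
by rewrite scale0r scaler0.
Qed.

Lemma verma_cartan_raising i j :
  ⁅cartan i, raising j⁆ = (A i j)%:~R *: raising j.
Proof.
apply: gl_ext => phi; apply/funext => w.
rewrite gl_lbrE -[LHS]/(2%:R^-1 *: (cartan i (raising j phi) w -
  raising j (cartan i phi) w)).
rewrite raisingE !cartanE !raisingE -scalerBl scalerA.
rewrite gl_scaleE -[RHS]/((A i j)%:~R *: phi (j :: w)); congr (_ *: _).
rewrite /verma_weight big_cons; field; exact: two_neq0.
Qed.

Lemma verma_cartan_comm i j : ⁅cartan i, cartan j⁆ = 0.
Proof.
apply: gl_ext => phi; apply/funext => w.
rewrite gl_lbrE -[LHS]/(2%:R^-1 *: (cartan i (cartan j phi) w -
  cartan j (cartan i phi) w)).
by rewrite !cartanE !scalerA mulrC subrr scaler0.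
Qed.

Lemma verma_chevalley_relations : chevalley_relations A raising lowering cartan.
Proof.
have hh := verma_cartan_comm.
have ef i : ⁅raising i, lowering i⁆ = cartan i.
  by rewrite verma_raising_lowering; case: asboolP.
have ef0 i j : i <> j -> ⁅raising i, lowering j⁆ = 0.
  by move=> ij; rewrite verma_raising_lowering; case: asboolP => // /esym.
split.
- exact: verma_cartan_raising.
- move=> i j; apply/eqP; rewrite -subr_eq0; apply/eqP.
  apply: verma_operator_eq0 => [phi|k].
    rewrite gl_addE gl_oppE gl_scaleE.
    rewrite -[LHS]/(2%:R^-1 *: (cartan i (lowering j phi) [::] -
      lowering j (cartan i phi) [::]) - - (A i j)%:~R *: lowering j phi [::]).
    by rewrite cartan_nil !lowering_nil subrr !scaler0 subr0.
  exact: cartan_lowering_comm hh verma_cartan_raising ef ef0.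
- exact: ef.
- exact: ef0.
Qed.

(** A Serre element in the [f_i] commutes with the [e_k], and it vanishes at the
    empty word because the [f_i] do. *)
Lemma verma_lowering_serre z : serre_element A lowering z -> z = 0.
Proof.
move=> zS; apply: verma_operator_eq0 => [phi|k]; last first.
  exact: serre_element_comm verma_chevalley_relations zS.
have lbr_nil i (X : gl dual_verma) : (forall psi, X psi [::] = 0) ->
    forall psi, gl_fun ⁅lowering i, X⁆ psi [::] = 0.
  move=> X0 psi; rewrite gl_lbrE -[LHS]/(2%:R^-1 *:
    (lowering i (X psi) [::] - X (lowering i psi) [::])).
  by rewrite X0 lowering_nil subr0 scaler0.
by case: zS phi => i j _ _; do !apply: (lbr_nil) => //.
Qed.

(** * The intertwining map for the compact generators *)

(** Locality makes the recursion defining the intertwiner well founded. *)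
Lemma lowering_fun_local i phi psi w :
    (forall u, (size u < size w)%N -> phi u = psi u) ->
  lowering_fun i phi w = lowering_fun i psi w.
Proof.
elim: w phi psi => [//|j w IHw] phi psi eq_phi /=.
rewrite (eq_phi w) // (IHw (raising j phi) (raising j psi)) // => u lt_uw.
exact: eq_phi.
Qed.

Variable c : V -> gl S.
Hypothesis c_berman : berman_relations A c.

(** The number [n] is fuel: the value at [i :: w'] is that of
    [f_i (intertwiner s) + intertwiner (c_i s)] at [w'], which involves the
    intertwiner at words no longer than [w']. *)
Fixpoint intertwiner_upto n (s : S) w : S :=
  if n isn't n'.+1 then s else
  if w is i :: w' then
    lowering_fun i (intertwiner_upto n' s) w' + intertwiner_upto n' (c i s) w'
  else s.

Definition intertwiner s w := intertwiner_upto (size w) s w.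

Lemma intertwiner_uptoE n s w :
  (size w <= n)%N -> intertwiner_upto n s w = intertwiner s w.
Proof.
rewrite /intertwiner; have [m le_wm] := ubnP (size w).
elim: m => // m IHm in n s w le_wm *; case: n => [|n]; first by case: w le_wm.
case: w le_wm => //= i w le_wm le_wn; rewrite IHm //; congr (_ + _).
apply: lowering_fun_local => u lt_uw.
have lt_um : (size u < m)%N := ltn_trans lt_uw le_wm.
by rewrite !IHm //; apply: ltnW => //; apply: leq_trans lt_uw _.
Qed.

Lemma intertwiner_linear : linear intertwiner.
Proof.
move=> a s t; apply/funext => w.
rewrite -[RHS]/(a *: intertwiner s w + intertwiner t w) /intertwiner.
move: (size w) => n; elim: n w s t => // n IHn [//|i w] s t /=.
rewrite gl_linear IHn scalerDr addrACA; congr (_ + _).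
have -> : intertwiner_upto n (a *: s + t) =
    a *: intertwiner_upto n s + intertwiner_upto n t.
  by apply/funext => u; rewrite IHn.
by rewrite lowering_linear.
Qed.

(** The recursion is the equation [e_i (j s) = f_i (j s) + j (c_i s)], where [j]
    is the intertwiner. *)
Lemma compact_intertwiner i :
  equivariant intertwiner (c i) (raising i - lowering i).
Proof.
move=> s; apply/funext => w; rewrite gl_addE gl_oppE.
rewrite -[LHS]/(intertwiner s (i :: w) - lowering i (intertwiner s) w).
rewrite {1}/intertwiner /= addrC intertwiner_uptoE //.
rewrite (@lowering_fun_local _ _ (intertwiner s)) ?addKr // => u lt_uw.
exact/intertwiner_uptoE/ltnW.
Qed.

(** The Serre element is a Berman relator in the [e_i - f_i], which acts on the
    image of the intertwiner as the vanishing Berman relator in the [c_i], plus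
    or minus a Serre element in the [f_i], which is zero. *)
Lemma raising_serre_intertwiner z s :
  serre_element A raising z -> gl_fun z (intertwiner s) = 0.
Proof.
have int0 : intertwiner 0 = 0.
  by have := intertwiner_linear (-1) 0 0; rewrite scaler0 addr0 scaleN1r addNr.
have xE := compact_intertwiner; have cE := verma_chevalley_relations.
have xxE i j := equivariant_lbr intertwiner_linear (xE i) (xE j).
case=> i j ij Aij.
- have <- : ⁅raising i - lowering i, raising j - lowering j⁆ =
      ⁅raising i, raising j⁆.
    rewrite (compact_bracket cE ij) (verma_lowering_serre (z := ⁅lowering i, _⁆)).
      by rewrite addr0.
    exact: serre_nadj.
  by rewrite xxE (c_berman ij).1 // gl_0E int0.
have lhs : ⁅raising i, ⁅raising i, raising j⁆⁆ =
    ⁅raising i - lowering i, ⁅raising i - lowering i, raising j - lowering j⁆⁆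
      + (raising j - lowering j).
  rewrite (compact_double_bracket cE ij) Aij scaleN1r.
  rewrite (verma_lowering_serre (z := ⁅lowering i, ⁅_, _⁆⁆)) ?subr0 ?subrK //.
  exact: serre_adj.
rewrite lhs gl_addE (equivariant_lbr intertwiner_linear (xE i) (xxE i j)) xE.
rewrite (c_berman ij).2 //.
by rewrite gl_oppE -[intertwiner (c j s)]scale1r addrC -intertwiner_linear
  scale1r subrr int0.
Qed.

(** * The Kac-Moody module generated by the intertwiner *)

(** Closure under the [e_i] is not imposed, so that an induction need not deal
    with the [e_i], with which Serre elements in the [e_i] do not commute. *)
Inductive spin_submodule : dual_verma -> Prop :=
| spin_intertwiner s : spin_submodule (intertwiner s)
| spin_linear a phi psi :
    spin_submodule phi -> spin_submodule psi -> spin_submodule (a *: phi + psi)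
| spin_cartan i phi : spin_submodule phi -> spin_submodule (cartan i phi)
| spin_lowering i phi : spin_submodule phi -> spin_submodule (lowering i phi).

Lemma spin_submodule0 : spin_submodule 0.
Proof.
by rewrite -(addNr (intertwiner 0)) -scaleN1r; do !constructor.
Qed.

(** On the generators [e_k] is [f_k] plus an endomorphism of [S], and it moves
    past [f_i] and [h_i] at the cost of terms without [e]. *)
Lemma spin_raising k phi : spin_submodule phi -> spin_submodule (raising k phi).
Proof.
have [he _ ef ef0] := verma_chevalley_relations.
elim=> {phi} [s|a phi psi _ IHphi _ IHpsi|i phi phiS IHphi|i phi phiS IHphi].
- have := compact_intertwiner k s; rewrite gl_addE gl_oppE.
  move/eqP; rewrite subr_eq addrC => /eqP ->.
  by rewrite -[lowering k _]scale1r; do !constructor.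
- by rewrite gl_linear; constructor.
- rewrite (gl_swap _ _ _ two_neq0) lbrC he addrC gl_oppE gl_scaleE.
  by rewrite scalerN scalerA -scaleNr; do !constructor.
- rewrite (gl_swap _ _ _ two_neq0) addrC; have [<-|ki] := pselect (k = i).
    rewrite ef; apply: spin_linear; first exact: spin_cartan.
    exact: spin_lowering.
  by rewrite ef0 // gl_0E scaler0 add0r; apply: spin_lowering.
Qed.

Lemma raising_serre_spin z phi :
  serre_element A raising z -> spin_submodule phi -> gl_fun z phi = 0.
Proof.
have chev := verma_chevalley_relations.
move=> zS.
elim=> {phi} [s|a phi psi _ IHphi _ IHpsi|i phi _ IHphi|i phi _ IHphi].
- exact: raising_serre_intertwiner.
- by rewrite gl_linear IHphi IHpsi scaler0 addr0.
- have [b hz] := serre_element_weight i chev zS.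
  rewrite (gl_swap _ _ _ two_neq0) IHphi gl_fun0 lbrC hz gl_oppE gl_scaleE IHphi.
  by rewrite !scaler0 oppr0 scaler0 addr0.
- have fz := serre_element_comm slA i (chevalley_involution chev) zS.
  rewrite (gl_swap _ _ _ two_neq0) IHphi gl_fun0 lbrC fz oppr0 gl_0E.
  by rewrite scaler0 addr0.
Qed.

Definition spin_pred : {pred dual_verma} :=
  fun phi => `[< spin_submodule phi >].

Fact spin_submod_closed : GRing.subsemimod_closed spin_pred.
Proof.
split; first split.
- exact/asboolP/spin_submodule0.
- move=> phi psi /asboolP phiS /asboolP psiS; apply/asboolP.
  by rewrite -[phi]scale1r; apply: spin_linear.
- move=> a phi /asboolP phiS; apply/asboolP; rewrite -[_ *: _]addr0.
  by apply: spin_linear => //; apply: spin_submodule0.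
Qed.

Definition spin_module : Type := {phi : dual_verma | phi \in spin_pred}.

HB.instance Definition _ := SubChoice.on spin_module.
HB.instance Definition _ := GRing.SubChoice_isSubLmodule.Build F dual_verma
  spin_pred spin_module spin_submod_closed.

Definition stabilizes_spin (X : gl dual_verma) : Prop :=
  forall phi, spin_submodule phi -> spin_submodule (X phi).

Section Restriction.
Variables (X : gl dual_verma) (XS : stabilizes_spin X).

Definition restriction_fun (phi : spin_module) : spin_module :=
  exist _ (X (val phi))
    (introT (asboolP _) (XS (elimT (asboolP _) (valP phi)))).

Fact restriction_linear : linear restriction_fun.
Proof. by move=> a phi psi; apply: val_inj; rewrite /= -gl_linear. Qed.

Definition restriction : gl spin_module := gl_of restriction_linear.

End Restriction.

Local Notation inclusion := (fun v : spin_module => val v).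

Fact inclusion_linear : linear inclusion.
Proof. by []. Qed.

Lemma restriction_eq X' Y' X Y :
    equivariant inclusion X' X -> equivariant inclusion Y' Y ->
  (forall phi, spin_submodule phi -> X phi = Y phi) -> X' = Y'.
Proof.
move=> actX actY XY; apply: gl_ext => v; apply: val_inj.
by rewrite /= -actX -actY XY //; apply/asboolP/(valP v).
Qed.

Definition km_operator (g : km_index V) : gl spin_module :=
  match g with
  | KM_e i => restriction (@spin_raising i)
  | KM_f i => restriction (@spin_lowering i)
  | KM_h i => restriction (@spin_cartan i)
  end.

Lemma km_operator_rel s t :
  km_rel A s t -> lie_eval km_operator s = lie_eval km_operator t.
Proof.
have [he hf ef ef0] := verma_chevalley_relations.
have eA i : equivariant inclusion (km_operator (KM_e i)) (raising i) by [].
have fA i : equivariant inclusion (km_operator (KM_f i)) (lowering i) by [].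
have hA i : equivariant inclusion (km_operator (KM_h i)) (cartan i) by [].
have lbrA := equivariant_lbr inclusion_linear.
have scaleA := equivariantZ inclusion_linear.
have zeroA := equivariant0 inclusion_linear.
have ee0 i j : i <> j -> A i j = 0 ->
    ⁅km_operator (KM_e i), km_operator (KM_e j)⁆ = 0.
  move=> ij Aij; apply: restriction_eq (lbrA _ _ _ _ (eA i) (eA j)) zeroA _.
  by move=> phi phiS; rewrite (raising_serre_spin (serre_nadj _ ij Aij)).
case=> [i j|i j|i j|i|i j ij|i j ij Aij|i j ij Aij|i j ij|i j ij].
- apply: restriction_eq (lbrA _ _ _ _ (hA i) (hA j)) zeroA _.
  by rewrite verma_cartan_comm.
- apply: restriction_eq (lbrA _ _ _ _ (hA i) (eA j)) (scaleA _ _ _ (eA j)) _.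
  by rewrite he.
- apply: restriction_eq (lbrA _ _ _ _ (hA i) (fA j)) (scaleA _ _ _ (fA j)) _.
  by rewrite hf.
- apply: restriction_eq (lbrA _ _ _ _ (eA i) (fA i)) (hA i) _.
  by rewrite ef.
- apply: restriction_eq (lbrA _ _ _ _ (eA i) (fA j)) zeroA _.
  by rewrite ef0.
- exact: ee0.
- apply: restriction_eq (lbrA _ _ _ _ (fA i) (fA j)) zeroA _.
  by rewrite (verma_lowering_serre (serre_nadj _ ij Aij)).
- have [Aij|Aij] := (slA.2 i j ij).2.
    by rewrite /= ee0 // lbr0r.
  have eeA := lbrA _ _ _ _ (eA i) (eA j).
  apply: restriction_eq (lbrA _ _ _ _ (eA i) eeA) zeroA _.
  by move=> phi phiS; rewrite (raising_serre_spin (serre_adj _ ij Aij)).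
- have ffA := lbrA _ _ _ _ (fA i) (fA j).
  apply: restriction_eq (lbrA _ _ _ _ (fA i) ffA) zeroA _.
  have [Aij|Aij] := (slA.2 i j ij).2.
    by rewrite (verma_lowering_serre (serre_nadj _ ij Aij)) lbr0r.
  by rewrite (verma_lowering_serre (serre_adj _ ij Aij)).
Qed.

Definition spin_embedding s : spin_module :=
  exist _ (intertwiner s) (introT (asboolP _) (spin_intertwiner s)).

Fact spin_embedding_linear : linear spin_embedding.
Proof. by move=> a s t; apply: val_inj; rewrite /= intertwiner_linear. Qed.

(** This is the universal property in Berman's presentation of the compact
    subalgebra, for representations instead of Lie algebras: an element of the compact subalgebra maps
    the image of [S] to itself because the [x_i] do, and evaluation at the empty
    word reads off the induced endomorphism of [S]. *)
Lemma compact_subalgebra_universal :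
  exists rho : compact_subalgebra F A -> gl S,
    lie_hom rho /\ forall i, rho (compact_gen F A i) = c i.
Proof.
have [act [actH act_gen]] := presented_lie_universal km_operator_rel.
have emb_linear := spin_embedding_linear.
pose rho_fun (z : compact_subalgebra F A) s : S :=
  val (gl_fun (act (val z)) (spin_embedding s)) [::].
have rho_linear z : linear (rho_fun z).
  by move=> a s t; rewrite /rho_fun emb_linear gl_linear.
pose rho z : gl S := gl_of (rho_linear z).
pose rho_is (z : compact_subalgebra F A) (X : gl S) :=
  equivariant spin_embedding X (act (val z)).
(* evaluation at the empty word inverts the embedding on its image *)
have rhoP z X : rho_is z X -> rho z = X.
  by move=> zX; apply: gl_ext => s; rewrite /rho gl_ofE /rho_fun zX.
have rho_gen i : rho_is (compact_gen F A i) (c i).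
  move=> s; apply: val_inj; rewrite /= (lie_homB actH) !act_gen.
  exact: compact_intertwiner.
have rho_lin (a : F) x y X Y :
    rho_is x X -> rho_is y Y -> rho_is (a *: x + y) (a *: X + Y).
  by move=> xX yY; rewrite /rho_is /= actH.1; apply: equivariant_lin.
have rho_lbr x y X Y : rho_is x X -> rho_is y Y -> rho_is ⁅x, y⁆ ⁅X, Y⁆.
  by move=> xX yY; rewrite /rho_is /= actH.2; apply: equivariant_lbr.
have rho_ex z : rho_is z (rho z).
  suff [X zX] : exists X, rho_is z X by rewrite (rhoP _ _ zX).
  elim/generated_subalgebra_ind: z =>
    [x Sx|a x y [X xX] [Y yY]|x y [X xX] [Y yY]|].
  - have [i _ xE] := Sx; exists (c i).
    by have <- : compact_gen F A i = span_gen Sx by apply: val_inj.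
  - by exists (a *: X + Y); apply: rho_lin.
  - by exists ⁅X, Y⁆; apply: rho_lbr.
  - by exists 0; rewrite /rho_is /= (lie_hom0 actH); apply: equivariant0.
exists rho; split; first split.
- by move=> a x y; apply/rhoP/rho_lin.
- by move=> x y; apply/rhoP/rho_lbr.
- by move=> i; apply/rhoP.
Qed.

End ContragredientVerma.

(** * The graph algebra and its left regular representation *)

Section LeftRegular.
Variables (F : fieldType) (G : Type) (R : alg_term F G -> alg_term F G -> Prop).
Local Notation B := (presented_alg R).

Fact left_mul_linear (x : B) : linear ( *%R x : B -> B).
Proof. by move=> a y z; rewrite mulrDr -pa_scaleAr. Qed.

Definition left_mul (x : B) : gl B := gl_of (left_mul_linear x).

Lemma left_mulE (x y : B) : gl_fun (left_mul x) y = x * y.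
Proof. by []. Qed.

Lemma presented_alg_lbrE (x y : B) :
  ⁅x, y⁆ = (2%:R : F)^-1 *: (x * y - y * x).
Proof. by []. Qed.

Lemma left_mul_lie_hom : lie_hom left_mul.
Proof.
split=> [a x y|x y]; apply: gl_ext => z.
- by rewrite gl_addE gl_scaleE !left_mulE mulrDl pa_scaleAl.
- rewrite gl_lbrE !left_mulE presented_alg_lbrE -pa_scaleAl mulrBl.
  by rewrite !mulrA.
Qed.

Lemma left_mul_inj : injective left_mul.
Proof.
move=> x y xy; have := congr1 (fun f : gl B => gl_fun f 1) xy.
by rewrite !left_mulE !mulr1.
Qed.

End LeftRegular.

Section GraphAlgebraRelations.
Variables (F : fieldType) (V : Type) (A : V -> V -> int).
Hypothesis charF0 : [pchar F] =i pred0.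
Hypothesis slA : simply_laced_gcm A.
Local Notation Gamma := (gcm_graph F slA).
Local Notation g := (graph_algebra_gen Gamma).

Let two_neq0 : (2%:R : F) != 0 := char0_two_neq0 charF0.

Lemma graph_gen_sq v : g v * g v = -1.
Proof.
rewrite -[RHS]scaleN1r; transitivity (\pi_(graph_algebra Gamma)
  (AMul (AGen v) (AGen v) : alg_term F V)); first exact: pa_mulE.
transitivity (\pi_(graph_algebra Gamma)
  (AScale (-1) AOne : alg_term F V)); last exact/esym/pa_scaleE.
exact/presented_alg_eqP/ac_rel/(cl_sq Gamma).
Qed.

Lemma graph_gen_adj v w : gcm_adj A v w -> g v * g w = - (g w * g v).
Proof.
move=> vw; apply/eqP; rewrite -addr_eq0; apply/eqP.
transitivity (\pi_(graph_algebra Gamma) (AAdd (AMul (AGen v) (AGen w))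
   (AMul (AGen w) (AGen v)) : alg_term F V)).
  by rewrite -pa_addE -!pa_mulE.
exact/presented_alg_eqP/ac_rel/(@cl_adj F V Gamma).
Qed.

Lemma graph_gen_nadj v w : ~ gcm_adj A v w -> g v * g w = g w * g v.
Proof.
move=> vw; apply/eqP; rewrite -subr_eq0; apply/eqP.
transitivity (\pi_(graph_algebra Gamma) (AAdd (AMul (AGen v) (AGen w))
   (AOpp (AMul (AGen w) (AGen v))) : alg_term F V)).
  by rewrite -pa_addE -pa_oppE -!pa_mulE.
exact/presented_alg_eqP/ac_rel/(@cl_nadj F V Gamma).
Qed.

(** For adjacent vertices [g i * g j] equals its own bracket, and
    [g i * g i * g j = - g j]. *)
Lemma graph_gen_berman : berman_relations A g.
Proof.
move=> i j ij; split=> Aij.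
  have gC : g i * g j = g j * g i.
    by apply: graph_gen_nadj; case=> _; rewrite Aij.
  by rewrite presented_alg_lbrE gC subrr scaler0.
have gij : gcm_adj A i j by split=> //; rewrite Aij.
have gC := graph_gen_adj gij.
have half (x : graph_algebra Gamma) : (2%:R : F)^-1 *: (x + x) = x.
  by rewrite -mulr2n -scaler_nat scalerA mulVf // scale1r.
have -> : ⁅g i, g j⁆ = g i * g j.
  by rewrite presented_alg_lbrE (graph_gen_adj (gcm_adj_sym slA gij)) opprK half.
rewrite presented_alg_lbrE -mulrA -[g j * g i]opprK -gC mulrN opprK.
by rewrite mulrA graph_gen_sq mulN1r half.
Qed.

End GraphAlgebraRelations.

Theorem corollary11p5 (F : fieldType) (charF0 : [pchar F] =i pred0)
    (V : Type) (A : V -> V -> int) (slA : simply_laced_gcm A) :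
  (exists I : lie_ideal (compact_subalgebra F A),
     lie_isomorphic (lie_quot I) (graph_lie (gcm_graph F slA))) /\
  (exists (W : lmodType F) (phi : compact_subalgebra F A -> gl W),
     is_generalized_spin_rep phi).
Proof.
pose Gamma := gcm_graph F slA; pose B := graph_algebra Gamma.
have LH : lie_hom (@left_mul F V (clifford_rel Gamma)) := left_mul_lie_hom _.
have L_berman : berman_relations A
    (fun i => left_mul (graph_algebra_gen Gamma i)).
  move=> i j ij; have [c0 c1] := graph_gen_berman charF0 slA ij.
  rewrite -!LH.2 -(lie_homN LH); split=> Aij; last by rewrite c1.
  by rewrite c0 // (lie_hom0 LH).
have [rho [rhoH rho_gen]] := compact_subalgebra_universal charF0 slA L_berman.
split; last first.
  exists B, rho; split=> // i; rewrite rho_gen expr2; apply: gl_ext => x.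
  by rewrite gl_mulE !left_mulE mulrA graph_gen_sq mulN1r.
(* rho takes its values in the left multiplications by the Lie algebra of the
   graph, because it does so on generators *)
have /choice [psi psiE] : forall z, exists y : graph_lie Gamma,
    rho z = left_mul (val y).
  elim/generated_subalgebra_ind=> [x Sx|a x y [u xu] [v yv]|x y [u xu] [v yv]|].
  - have [i _ xE] := Sx; exists (span_gen (imageT (graph_algebra_gen Gamma) i)).
    by have <- : compact_gen F A i = span_gen Sx by apply: val_inj.
  - by exists (a *: u + v); rewrite rhoH.1 xu yv -LH.1.
  - by exists ⁅u, v⁆; rewrite rhoH.2 xu yv -LH.2.
  - by exists 0; rewrite (lie_hom0 rhoH) (lie_hom0 LH).
have psiP z y : rho z = left_mul (val y) -> psi z = y.
  by rewrite psiE => /left_mul_inj /val_inj.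
have psiH : lie_hom psi.
  split=> [a x y|x y]; apply: psiP.
  - by rewrite rhoH.1 !psiE -LH.1.
  - by rewrite rhoH.2 !psiE -LH.2.
exists (lie_kernel psiH); apply: lie_first_isomorphism.
elim/generated_subalgebra_ind=> [x Sx|a _ _ [x <-] [y <-]|_ _ [x <-] [y <-]|].
- have [i _ xE] := Sx; exists (compact_gen F A i); apply: psiP.
  by rewrite rho_gen /= xE.
- by exists (a *: x + y); rewrite psiH.1.
- by exists ⁅x, y⁆; rewrite psiH.2.
- by exists 0; rewrite (lie_hom0 psiH).
Qed.
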